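(* Let $F$ be an algebraically closed field of characteristic $0$. Let $L$ be a three dimensional Lie algebra over $F$ with a regular plus-minus pair. Then $L$ is isomorphic to one of $sl_2$, $\mathfrak H$, or $\mathfrak A(r)$ for some $r\in \mathbf P^1(F)=F\cup\{\infty\}$.
   Context: For a Lie algebra $\mathfrak a$ over $F$, $U(\mathfrak a)$ denotes its universal enveloping algebra; for a subalgebra $\mathfrak b\subseteq\mathfrak a$, $U(\mathfrak b)$ is regarded as a subalgebra of $U(\mathfrak a)$. For subspaces $A,B$ of $U(\mathfrak a)$, $AB$ denotes the linear span of all products $ab$ with $a\in A$, $b\in B$. A Lie algebra $L$ has a plus-minus pair $(P,M)$ if $P,M$ are subalgebras of $L$ with $P+M\neq L$ (vector space sum) and $U(L)=U(P)U(M)U(P)$. A plus-minus pair $(P,M)$ of $L$ is regular if $P\cap M=(0)$ and there is an automorphism $\sigma$ of $L$ of order two with $\sigma(P)=M$. $sl_2$ is the Lie algebra of trace zero $2\times 2$ matrices over $F$. $\mathfrak H$ is the three dimensional Heisenberg Lie algebra with basis $x,y,z$ and brackets $[x,y]=z$, $[x,z]=[y,z]=0$. For $r\in \mathbf P^1(F)=F\cup\{\infty\}$, $\mathfrak A(r)$ is the three dimensional Lie algebra of $3\times3$ matrices over $F$ (with the commutator bracket) spanned by $A(r),X,Y$, where $$A(r)=\left(\begin{array}{ccc}0&r&0\\1&1&0\\0&0&0\end{array}\right)\ (r\in F),\qquad A(\infty)=\left(\begin{array}{ccc}0&1&0\\1&0&0\\0&0&0\end{array}\right),$$ $$X=\left(\begin{array}{ccc}0&0&1\\0&0&0\\0&0&0\end{array}\right),\qquad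 Y=\left(\begin{array}{ccc}0&0&0\\0&0&1\\0&0&0\end{array}\right).$$ *)

(* Defs.v *)
From HB Require Import structures.
From mathcomp Require Import all_boot all_order all_algebra.
From mathcomp Require Import boolp classical_sets.
From mathcomp Require Import ring.

Set Implicit Arguments.
Unset Strict Implicit.
Unset Printing Implicit Defensive.

Import GRing.Theory.
Local Open Scope ring_scope.
Local Open Scope quotient_scope.

HB.mixin Record Lmodule_isLie (F : fieldType) L of GRing.Lmodule F L := {
  lie : L -> L -> L;
  lie_linearl : forall y, linear (lie^~ y);
  lie_linearr : forall x, linear (lie x);
  liexx : forall x, lie x x = 0;
  lie_jacobi : forall x y z,
    lie x (lie y z) + lie y (lie z x) + lie z (lie x y) = 0
}.

#[short(type="lieAlgType")]
HB.structure Definition LieAlgebra (F : fieldType) :=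
  {L of GRing.Lmodule F L & Lmodule_isLie F L}.

#[short(type="lieVectType")]
HB.structure Definition LieVector (F : fieldType) :=
  {L of Vector F L & LieAlgebra F L}.

Notation "[ 'Lie' x , y ]" := (lie x y)
  (at level 0, x, y at level 99, format "[ 'Lie'  x ,  y ]") : ring_scope.

Section LieTheory.
Variables (F : fieldType) (L : lieAlgType F).
Implicit Types (x y z : L) (a : F).

HB.instance Definition _ x :=
  GRing.isLinear.Build F L L *:%R (lie x) (lie_linearr x).

Lemma lieDl x y z : [Lie x + y, z] = [Lie x, z] + [Lie y, z].
Proof. by have := lie_linearl z 1 x y; rewrite /= !scale1r. Qed.

Lemma lieZl a x y : [Lie a *: x, y] = a *: [Lie x, y].
Proof.
have := lie_linearl y a x 0; rewrite /= !addr0 => ->.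
have := lie_linearl y (-1) x x; rewrite /= !scaleN1r !addNr => ->.
by rewrite addr0.
Qed.

Lemma lieDr x y z : [Lie x, y + z] = [Lie x, y] + [Lie x, z].
Proof. exact: linearD. Qed.

Lemma lieZr a x y : [Lie x, a *: y] = a *: [Lie x, y].
Proof. exact: linearZ. Qed.

Lemma lieC x y : [Lie x, y] = - [Lie y, x].
Proof.
apply/eqP; rewrite -addr_eq0; apply/eqP.
by have := liexx (x + y); rewrite lieDl !lieDr !liexx add0r addr0.
Qed.

End LieTheory.

Definition lie_morphism (F : fieldType) (L L' : lieAlgType F) (f : L -> L') :=
  forall x y, f [Lie x, y] = [Lie f x, f y].

Definition lie_iso (F : fieldType) (L L' : lieAlgType F) : Prop :=
  exists f : {linear L -> L'}, lie_morphism f /\ bijective f.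

Record lieSubalg (F : fieldType) (L : lieVectType F) := LieSubalg {
  lieSubalg_space :> {vspace L};
  lieSubalg_closed : forall x y,
    x \in lieSubalg_space -> y \in lieSubalg_space ->
    [Lie x, y] \in lieSubalg_space
}.

Definition lieSub (F : fieldType) (L : lieVectType F) (P : lieSubalg L) : Type :=
  subvs_of P.

Section LieSub.
Variables (F : fieldType) (L : lieVectType F) (P : lieSubalg L).

HB.instance Definition _ := Vector.on (lieSub P).

Definition lieSub_val (u : lieSub P) : L := vsval u.

Definition lieSub_lie (u v : lieSub P) : lieSub P :=
  Subvs (lieSubalg_closed (subvsP u) (subvsP v)).

Lemma lieSub_val_is_linear : linear lieSub_val.
Proof. exact: linearP. Qed.
HB.instance Definition _ :=
  GRing.isLinear.Build F (lieSub P) L *:%R lieSub_val lieSub_val_is_linear.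

Lemma lieSub_val_inj : injective lieSub_val.
Proof. exact: subvs_inj. Qed.

Fact lieSub_linearl y : linear (lieSub_lie^~ y).
Proof.
move=> a u v; apply: lieSub_val_inj; rewrite linearP /= /lieSub_val /=.
exact: (lie_linearl (vsval y) a).
Qed.

Fact lieSub_linearr x : linear (lieSub_lie x).
Proof.
move=> a u v; apply: lieSub_val_inj; rewrite linearP /= /lieSub_val /=.
exact: (lie_linearr (vsval x) a).
Qed.

Fact lieSubxx x : lieSub_lie x x = 0.
Proof. by apply: lieSub_val_inj; rewrite linear0 /= [LHS]liexx. Qed.

Fact lieSub_jacobi x y z :
  lieSub_lie x (lieSub_lie y z) + lieSub_lie y (lieSub_lie z x)
  + lieSub_lie z (lieSub_lie x y) = 0.
Proof. by apply: lieSub_val_inj; rewrite !linearD linear0 /= [LHS]lie_jacobi. Qed.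

HB.instance Definition _ := Lmodule_isLie.Build F (lieSub P)
  lieSub_linearl lieSub_linearr lieSubxx lieSub_jacobi.

Lemma lieSub_val_lie : lie_morphism lieSub_val.
Proof. by []. Qed.

End LieSub.

(* The universal enveloping algebra U(L) is the associative unital F-algebra
   presented by the generators UGen x (x in L), subject to linearity of UGen and to
   xy - yx = [x, y]. It is built as the quotient of the formal expressions
   by the smallest congruence containing the algebra axioms and these
   relations; uea_lift and uea_lift_unique give its universal property. *)
Inductive uterm (F : fieldType) (L : lieAlgType F) : Type :=
  | UScal of F
  | UGen of L
  | UAdd of uterm L & uterm L
  | UMul of uterm L & uterm L.

Arguments UScal {F L}.

Inductive ucong (F : fieldType) (L : lieAlgType F) :
    uterm L -> uterm L -> Prop :=
  | UC_refl t : ucong t t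
  | UC_sym s t : ucong s t -> ucong t s
  | UC_trans s t u : ucong s t -> ucong t u -> ucong s u
  | UC_add s s' t t' : ucong s s' -> ucong t t' -> ucong (UAdd s t) (UAdd s' t')
  | UC_mul s s' t t' : ucong s s' -> ucong t t' -> ucong (UMul s t) (UMul s' t')
  | UC_addA s t u : ucong (UAdd s (UAdd t u)) (UAdd (UAdd s t) u)
  | UC_addC s t : ucong (UAdd s t) (UAdd t s)
  | UC_add0 t : ucong (UAdd (UScal 0) t) t
  | UC_mulA s t u : ucong (UMul s (UMul t u)) (UMul (UMul s t) u)
  | UC_mul1l t : ucong (UMul (UScal 1) t) t
  | UC_mul0l t : ucong (UMul (UScal 0) t) (UScal 0)
  | UC_mulDl s t u : ucong (UMul (UAdd s t) u) (UAdd (UMul s u) (UMul t u))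
  | UC_mulDr s t u : ucong (UMul s (UAdd t u)) (UAdd (UMul s t) (UMul s u))
  | UC_scalD a b : ucong (UScal (a + b)) (UAdd (UScal a) (UScal b))
  | UC_scalM a b : ucong (UScal (a * b)) (UMul (UScal a) (UScal b))
  | UC_scalC a t : ucong (UMul (UScal a) t) (UMul t (UScal a))
  | UC_gen a x y :
      ucong (UGen (a *: x + y)) (UAdd (UMul (UScal a) (UGen x)) (UGen y))
  | UC_lie x y :
      ucong (UMul (UGen x) (UGen y))
            (UAdd (UMul (UGen y) (UGen x)) (UGen [Lie x, y])).

HB.instance Definition _ (F : fieldType) (L : lieAlgType F) :=
  gen_eqMixin (uterm L).
HB.instance Definition _ (F : fieldType) (L : lieAlgType F) :=
  gen_choiceMixin (uterm L).

Section UEA.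
Variables (F : fieldType) (L : lieAlgType F).
Implicit Types s t : uterm L.

Definition ucongb : rel (uterm L) := fun s t => `[< ucong s t >].

Fact ucongb_equiv : equiv_class_of ucongb.
Proof.
split=> [t|s t|t s u].
- exact/asboolP/UC_refl.
- by apply/asboolP/asboolP => /UC_sym.
- by move=> /asboolP st /asboolP tu; apply/asboolP/(UC_trans st tu).
Qed.

Canonical ucongb_equiv_rel := EquivRelPack ucongb_equiv.

Definition uea : Type := {eq_quot ucongb}.
HB.instance Definition _ := Choice.on uea.
HB.instance Definition _ := EqQuotient.on uea.

Definition uea_class (t : uterm L) : uea := \pi_uea t.

Lemma uea_eqP s t : uea_class s = uea_class t <-> ucong s t.
Proof.
by split=> [/eqP|st]; [rewrite eqmodE => /asboolP | apply/eqP; rewrite eqmodE; apply/asboolP].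
Qed.

Lemma uea_ind (Q : uea -> Prop) : (forall t, Q (uea_class t)) -> forall u, Q u.
Proof. by move=> H u; rewrite -[u]reprK; exact: H. Qed.

Definition uea_scal (a : F) : uea := uea_class (UScal a).
Definition uea_add (u v : uea) : uea := uea_class (UAdd (repr u) (repr v)).
Definition uea_mul (u v : uea) : uea := uea_class (UMul (repr u) (repr v)).

Lemma ucong_repr t : ucong (repr (uea_class t)) t.
Proof. by apply/uea_eqP; rewrite /uea_class reprK. Qed.

Lemma uea_addE s t : uea_add (uea_class s) (uea_class t) = uea_class (UAdd s t).
Proof. by apply/uea_eqP; apply: UC_add; apply: ucong_repr. Qed.

Lemma uea_mulE s t : uea_mul (uea_class s) (uea_class t) = uea_class (UMul s t).
Proof. by apply/uea_eqP; apply: UC_mul; apply: ucong_repr. Qed.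

Definition uea_opp : uea -> uea := uea_mul (uea_scal (-1)).

Fact uea_addA : associative uea_add.
Proof.
elim/uea_ind=> s; elim/uea_ind=> t; elim/uea_ind=> u.
by rewrite !uea_addE; apply/uea_eqP/UC_addA.
Qed.

Fact uea_addC : commutative uea_add.
Proof.
by elim/uea_ind=> s; elim/uea_ind=> t; rewrite !uea_addE; apply/uea_eqP/UC_addC.
Qed.

Fact uea_add0 : left_id (uea_scal 0) uea_add.
Proof. by elim/uea_ind=> t; rewrite uea_addE; apply/uea_eqP/UC_add0. Qed.

Fact uea_mulA : associative uea_mul.
Proof.
elim/uea_ind=> s; elim/uea_ind=> t; elim/uea_ind=> u.
by rewrite !uea_mulE; apply/uea_eqP/UC_mulA.
Qed.

Fact uea_scalC a u : uea_mul (uea_scal a) u = uea_mul u (uea_scal a).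
Proof. by elim/uea_ind: u => t; rewrite !uea_mulE; apply/uea_eqP/UC_scalC. Qed.

Fact uea_mul1l : left_id (uea_scal 1) uea_mul.
Proof. by elim/uea_ind=> t; rewrite uea_mulE; apply/uea_eqP/UC_mul1l. Qed.

Fact uea_mul1r : right_id (uea_scal 1) uea_mul.
Proof. by move=> u; rewrite -uea_scalC uea_mul1l. Qed.

Fact uea_mulDl : left_distributive uea_mul uea_add.
Proof.
elim/uea_ind=> s; elim/uea_ind=> t; elim/uea_ind=> u.
by rewrite !(uea_addE, uea_mulE); apply/uea_eqP/UC_mulDl.
Qed.

Fact uea_mulDr : right_distributive uea_mul uea_add.
Proof.
elim/uea_ind=> s; elim/uea_ind=> t; elim/uea_ind=> u.
by rewrite !(uea_addE, uea_mulE); apply/uea_eqP/UC_mulDr.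
Qed.

Fact uea_mul0l : left_zero (uea_scal 0) uea_mul.
Proof. by elim/uea_ind=> t; rewrite uea_mulE; apply/uea_eqP/UC_mul0l. Qed.

Fact uea_scalD a b : uea_scal (a + b) = uea_add (uea_scal a) (uea_scal b).
Proof. by rewrite uea_addE; apply/uea_eqP/UC_scalD. Qed.

Fact uea_scalM a b : uea_scal (a * b) = uea_mul (uea_scal a) (uea_scal b).
Proof. by rewrite uea_mulE; apply/uea_eqP/UC_scalM. Qed.

Fact uea_addN : left_inverse (uea_scal 0) uea_opp uea_add.
Proof.
move=> u; rewrite /uea_opp -[X in uea_add _ X]uea_mul1l -uea_mulDl -uea_scalD.
by rewrite addNr uea_mul0l.
Qed.

Fixpoint ueval (A : algType F) (f : L -> A) (t : uterm L) : A :=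
  match t with
  | UScal a => a%:A
  | UGen x => f x
  | UAdd s t => ueval f s + ueval f t
  | UMul s t => ueval f s * ueval f t
  end.

Lemma ueval_cong (A : algType F) (f : {linear L -> A}) s t :
    (forall x y, f [Lie x, y] = f x * f y - f y * f x) ->
  ucong s t -> ueval f s = ueval f t.
Proof.
move=> fL; elim=> //=.
- by move=> ? ? ? _ -> _ ->.
- by move=> ? ? ? ? _ -> _ ->.
- by move=> ? ? ? ? _ -> _ ->.
- by move=> ? ? ?; rewrite addrA.
- by move=> ? ?; rewrite addrC.
- by move=> ?; rewrite scale0r add0r.
- by move=> ? ? ?; rewrite mulrA.
- by move=> ?; rewrite scale1r mul1r.
- by move=> ?; rewrite scale0r mul0r.
- by move=> ? ? ?; rewrite mulrDl.
- by move=> ? ? ?; rewrite mulrDr.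
- by move=> ? ?; rewrite scalerDl.
- by move=> ? ?; rewrite mulr_algl scalerA.
- by move=> ? ?; rewrite mulr_algl mulr_algr.
- by move=> ? ? ?; rewrite linearP mulr_algl.
- by move=> ? ?; rewrite fL addrC subrK.
Qed.

Fact uea_oner_neq0 : uea_scal 1 != uea_scal 0.
Proof.
apply/eqP => /uea_eqP /(@ueval_cong F^o (\0 : {linear L -> F^o})) /=.
rewrite scale1r scale0r => /(_ _)/eqP; rewrite oner_eq0.
by move=> /(_ _)/negP[] // x y; rewrite mul0r subr0.
Qed.

HB.instance Definition _ :=
  GRing.isZmodule.Build uea uea_addA uea_addC uea_add0 uea_addN.
HB.instance Definition _ := GRing.Zmodule_isNzRing.Build uea
  uea_mulA uea_mul1l uea_mul1r uea_mulDl uea_mulDr uea_oner_neq0.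

Definition uea_scale (a : F) (u : uea) : uea := uea_scal a * u.

Fact uea_scaleA a b u : uea_scale a (uea_scale b u) = uea_scale (a * b) u.
Proof. by rewrite /uea_scale mulrA uea_scalM. Qed.
Fact uea_scale1 : left_id 1 uea_scale.
Proof. exact: mul1r. Qed.
Fact uea_scaleDr : right_distributive uea_scale +%R.
Proof. by move=> a u v; exact: mulrDr. Qed.
Fact uea_scaleDl u : {morph uea_scale^~ u : a b / a + b}.
Proof. by move=> a b; rewrite /uea_scale uea_scalD; exact: mulrDl. Qed.

HB.instance Definition _ := GRing.Zmodule_isLmodule.Build F uea
  uea_scaleA uea_scale1 uea_scaleDr uea_scaleDl.

Fact uea_scaleAl (a : F) (u v : uea) : a *: (u * v) = (a *: u) * v.
Proof. exact: mulrA. Qed.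
HB.instance Definition _ := GRing.Lmodule_isLalgebra.Build F uea uea_scaleAl.

Fact uea_scaleAr (a : F) (u v : uea) : a *: (u * v) = u * (a *: v).
Proof. by rewrite /GRing.scale /= /uea_scale mulrA [_ * u]uea_scalC -mulrA. Qed.
HB.instance Definition _ := GRing.Lalgebra_isAlgebra.Build F uea uea_scaleAr.

Lemma uea_classD s t : uea_class (UAdd s t) = uea_class s + uea_class t.
Proof. by rewrite -uea_addE. Qed.

Lemma uea_classM s t : uea_class (UMul s t) = uea_class s * uea_class t.
Proof. by rewrite -uea_mulE. Qed.

Lemma uea_classZ a t : uea_class (UMul (UScal a) t) = a *: uea_class t.
Proof. by rewrite -uea_mulE. Qed.

Lemma uea_classC a : uea_class (UScal a) = a%:A.
Proof. by rewrite [RHS]mulr1. Qed.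

Definition uea_gen (x : L) : uea := uea_class (UGen x).

Fact uea_gen_is_linear : linear uea_gen.
Proof.
by move=> a x y; rewrite -uea_classZ -uea_classD; apply/uea_eqP/UC_gen.
Qed.
HB.instance Definition _ :=
  GRing.isLinear.Build F L uea *:%R uea_gen uea_gen_is_linear.

Lemma uea_gen_lie x y :
  uea_gen [Lie x, y] = uea_gen x * uea_gen y - uea_gen y * uea_gen x.
Proof.
apply/eqP; rewrite eq_sym subr_eq addrC; apply/eqP.
rewrite -!uea_classM -uea_classD; exact/uea_eqP/UC_lie.
Qed.

Section Lift.
Variables (A : algType F) (f : {linear L -> A}).

Definition uea_lift (u : uea) : A := ueval f (repr u).

Hypothesis fL : forall x y, f [Lie x, y] = f x * f y - f y * f x.

Lemma uea_liftE t : uea_lift (uea_class t) = ueval f t.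
Proof. exact/ueval_cong/ucong_repr. Qed.

Lemma uea_lift_gen x : uea_lift (uea_gen x) = f x.
Proof. exact: uea_liftE. Qed.

Lemma uea_lift_is_linear : linear uea_lift.
Proof.
move=> a; elim/uea_ind=> s; elim/uea_ind=> t.
by rewrite -uea_classZ -uea_classD !uea_liftE /= mulr_algl.
Qed.

Lemma uea_lift_is_monoid_morphism : monoid_morphism uea_lift.
Proof.
split=> [|]; first by rewrite [LHS]uea_liftE /= scale1r.
elim/uea_ind=> s; elim/uea_ind=> t.
by rewrite -uea_classM !uea_liftE.
Qed.

Lemma uea_lift_unique (g : {lrmorphism uea -> A}) :
  (forall x, g (uea_gen x) = f x) -> g =1 uea_lift.
Proof.
move=> gf; elim/uea_ind=> t; rewrite uea_liftE; elim: t => [a|x|s IHs t IHt|s IHs t IHt] /=.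
- by rewrite uea_classC linearZ rmorph1.
- exact: gf.
- by rewrite uea_classD rmorphD /= IHs IHt.
- by rewrite uea_classM rmorphM /= IHs IHt.
Qed.

End Lift.
End UEA.

(* U(P) inside U(L): the image of the algebra morphism U(P) -> U(L) induced by
   the inclusion of P in L (which is injective by Poincare-Birkhoff-Witt). *)
Definition uea_sub_incl (F : fieldType) (L : lieVectType F) (P : lieSubalg L) :
    uea (lieSub P) -> uea L :=
  uea_lift (@uea_gen F L \o @lieSub_val F L P : {linear _ -> _}).

Definition uea_sub (F : fieldType) (L : lieVectType F) (P : lieSubalg L) :
    set (uea L) :=
  range (@uea_sub_incl F L P).

Lemma uea_sub_lie (F : fieldType) (L : lieVectType F) (P : lieSubalg L)
    (f : {linear lieSub P -> uea L} := @uea_gen F L \o @lieSub_val F L P)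
    (x y : lieSub P) :
  f [Lie x, y] = f x * f y - f y * f x.
Proof. exact: (uea_gen_lie (lieSub_val x) (lieSub_val y)). Qed.

Lemma uea_sub_incl_gen (F : fieldType) (L : lieVectType F) (P : lieSubalg L)
    (x : lieSub P) :
  uea_sub_incl (uea_gen x) = uea_gen (lieSub_val x).
Proof. exact/uea_lift_gen/uea_sub_lie. Qed.

(* S need not be finite and V need not be finite-dimensional, hence no
   {vspace V}. *)
Definition lspan (F : fieldType) (V : lmodType F) (S : set V) : set V :=
  [set u | exists (n : nat) (c : 'I_n -> F) (v : 'I_n -> V),
     (forall i, S (v i)) /\ u = \sum_(i < n) c i *: v i].

Definition prod_span (F : fieldType) (U : algType F) (A B : set U) : set U :=
  lspan [set a * b | a in A & b in B].

Definition plus_minus_pair (F : fieldType) (L : lieVectType F)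
    (P M : lieSubalg L) : Prop :=
  (P + M)%VS <> fullv /\
  setT = prod_span (prod_span (uea_sub P) (uea_sub M)) (uea_sub P).

Definition lie_involution (F : fieldType) (L : lieVectType F)
    (s : 'End(L)) : Prop :=
  [/\ lie_morphism s, bijective s, (s \o s = \1)%VF & s <> \1%VF].

Definition regular_plus_minus_pair (F : fieldType) (L : lieVectType F)
    (P M : lieSubalg L) : Prop :=
  [/\ plus_minus_pair P M,
      (P :&: M = 0)%VS &
      exists s : 'End(L), lie_involution s /\ (s @: P)%VS = M].

Section GL.
Variables (F : fieldType) (n : nat).

Definition mx_lie (A B : 'M[F]_n) : 'M[F]_n := A *m B - B *m A.

Fact mx_lie_linearl B : linear (mx_lie^~ B).
Proof.
move=> a X Y; rewrite /mx_lie mulmxDl mulmxDr -scalemxAl -scalemxAr scalerBr.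
by rewrite opprD addrACA.
Qed.
Fact mx_lie_linearr A : linear (mx_lie A).
Proof.
move=> a X Y; rewrite /mx_lie mulmxDl mulmxDr -scalemxAl -scalemxAr scalerBr.
by rewrite opprD addrACA.
Qed.
Fact mx_liexx A : mx_lie A A = 0.
Proof. exact: subrr. Qed.
Fact mx_lie_jacobi A B C :
  mx_lie A (mx_lie B C) + mx_lie B (mx_lie C A) + mx_lie C (mx_lie A B) = 0.
Proof.
rewrite /mx_lie !mulmxBl !mulmxBr !mulmxA.
by apply/matrixP => i j; rewrite !mxE; ring.
Qed.

HB.instance Definition _ := Lmodule_isLie.Build F 'M[F]_n
  mx_lie_linearl mx_lie_linearr mx_liexx mx_lie_jacobi.

End GL.

Section SL2.
Variable F : fieldType.

Definition sl2_space : {vspace 'M[F]_2} :=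
  lker (linfun (mxtrace : 'M[F]_2 -> F^o)).

Lemma mem_sl2_space (A : 'M[F]_2) : (A \in sl2_space) = (\tr A == 0).
Proof. by rewrite memv_ker lfunE. Qed.

Fact sl2_closed (A B : 'M[F]_2) :
  A \in sl2_space -> B \in sl2_space -> [Lie A, B] \in sl2_space.
Proof.
by move=> _ _; rewrite mem_sl2_space [lie A B]/(A *m B - B *m A) linearB /= mxtrace_mulC subrr.
Qed.

Definition sl2 : lieSubalg 'M[F]_2 := LieSubalg sl2_closed.

End SL2.

Definition heisenberg (F : fieldType) : Type := 'rV[F]_3.

Section Heisenberg.
Variable F : fieldType.
Local Notation H := (heisenberg F).

HB.instance Definition _ := Vector.on H.

Definition heis_coord (i : nat) (u : H) : F := (u : 'rV[F]_3) 0 (inord i).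

Definition heis_x : H := delta_mx 0 (inord 0) : 'rV[F]_3.
Definition heis_y : H := delta_mx 0 (inord 1) : 'rV[F]_3.
Definition heis_z : H := delta_mx 0 (inord 2) : 'rV[F]_3.

Definition heis_lie (u v : H) : H :=
  (heis_coord 0 u * heis_coord 1 v - heis_coord 1 u * heis_coord 0 v) *: heis_z.

Fact heis_lie_linearl v : linear (heis_lie^~ v).
Proof.
move=> a u w; rewrite /heis_lie scalerA -scalerDl /heis_coord !mxE.
by congr (_ *: _); ring.
Qed.
Fact heis_lie_linearr v : linear (heis_lie v).
Proof.
move=> a u w; rewrite /heis_lie scalerA -scalerDl /heis_coord !mxE.
by congr (_ *: _); ring.
Qed.
Fact heis_liexx u : heis_lie u u = 0.
Proof. by rewrite /heis_lie mulrC subrr scale0r. Qed.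
Lemma heis_coord_delta i j : (i < 3)%N -> (j < 3)%N ->
  heis_coord i (delta_mx 0 (inord j) : 'rV[F]_3) = (i == j)%:R.
Proof.
by move=> ilt jlt; rewrite /heis_coord mxE eqxx /= -(inj_eq val_inj) /= !inordK.
Qed.

Lemma heis_coordZ i a u : heis_coord i (a *: u) = a * heis_coord i u.
Proof. by rewrite /heis_coord mxE. Qed.

Fact heis_lie_jacobi u v w :
  heis_lie u (heis_lie v w) + heis_lie v (heis_lie w u)
  + heis_lie w (heis_lie u v) = 0.
Proof.
rewrite {1 3 5}/heis_lie !heis_coordZ !heis_coord_delta //=.
by rewrite !mulr0 !subrr !scale0r !addr0.
Qed.

HB.instance Definition _ := Lmodule_isLie.Build F H
  heis_lie_linearl heis_lie_linearr heis_liexx heis_lie_jacobi.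

Lemma heis_basis : basis_of fullv [:: heis_x; heis_y; heis_z].
Proof.
rewrite basisEdim dimvf dim_matrix andbT.
apply/subvP => u _.
rewrite (_ : u = heis_coord 0 u *: heis_x + heis_coord 1 u *: heis_y
                 + heis_coord 2 u *: heis_z); last first.
  apply/rowP => k; rewrite /heis_coord !mxE !eqxx /= -!(inj_eq val_inj) /= !inordK //.
  rewrite -[in LHS](inord_val k).
  by case: k => [[|[|[|//]]] ?] /=; rewrite !(mulr0, mulr1, addr0, add0r).
by rewrite !rpredD // rpredZ // memv_span // !inE eqxx ?orbT.
Qed.

Lemma heis_brackets :
  [/\ [Lie heis_x, heis_y] = heis_z, [Lie heis_x, heis_z] = 0
    & [Lie heis_y, heis_z] = 0].
Proof.
by split; rewrite [LHS]/(heis_lie _ _) /heis_lie !heis_coord_delta //=;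
  rewrite !(mulr0, mul0r, mulr1, subr0, subrr, scale0r, scale1r).
Qed.

End Heisenberg.

Section AlgebraA.
Variable F : fieldType.

Definition mx3 (rows : seq (seq F)) : 'M[F]_3 :=
  \matrix_(i < 3, j < 3) (nth [::] rows i)`_j.

(* An element of P^1(F) is an option F, with None standing for infinity. *)
Definition frakA_A (r : option F) : 'M[F]_3 :=
  if r is Some r' then
    mx3 [:: [:: 0; r'; 0]; [:: 1; 1; 0]; [:: 0; 0; 0]]
  else
    mx3 [:: [:: 0; 1; 0]; [:: 1; 0; 0]; [:: 0; 0; 0]].

Definition frakA_X : 'M[F]_3 :=
  mx3 [:: [:: 0; 0; 1]; [:: 0; 0; 0]; [:: 0; 0; 0]].

Definition frakA_Y : 'M[F]_3 :=
  mx3 [:: [:: 0; 0; 0]; [:: 0; 0; 1]; [:: 0; 0; 0]].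

Definition frakA_space (r : option F) : {vspace 'M[F]_3} :=
  <<[:: frakA_A r; frakA_X; frakA_Y]>>%VS.

Lemma frakA_lie_AX r : [Lie frakA_A r, frakA_X] = frakA_Y.
Proof.
rewrite [LHS]/(mx_lie _ _) /mx_lie; apply/matrixP => i j.
case: r => [r|]; rewrite !mxE !big_ord_recr !big_ord0 /= !mxE.
all: case: i => [[|[|[|//]]] ?]; case: j => [[|[|[|//]]] ?] /=; ring.
Qed.

Lemma frakA_lie_AY r : [Lie frakA_A r, frakA_Y] =
  if r is Some r' then r' *: frakA_X + frakA_Y else frakA_X.
Proof.
rewrite [LHS]/(mx_lie _ _) /mx_lie; apply/matrixP => i j.
case: r => [r|]; rewrite !mxE !big_ord_recr !big_ord0 /= !mxE.
all: case: i => [[|[|[|//]]] ?]; case: j => [[|[|[|//]]] ?] /=; ring.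
Qed.

Lemma frakA_lie_XY : [Lie frakA_X, frakA_Y] = 0.
Proof.
rewrite [LHS]/(mx_lie _ _) /mx_lie; apply/matrixP => i j.
rewrite !mxE !big_ord_recr !big_ord0 /= !mxE.
case: i => [[|[|[|//]]] ?]; case: j => [[|[|[|//]]] ?] /=; ring.
Qed.

Lemma frakA_spaceP r (A : 'M[F]_3) :
  reflect (exists a b c, A = a *: frakA_A r + b *: frakA_X + c *: frakA_Y)
          (A \in frakA_space r).
Proof.
apply: (iffP idP) => [|[a] [b] [c] ->]; last first.
  by rewrite !rpredD // rpredZ // memv_span // !inE eqxx ?orbT.
rewrite /frakA_space !span_cons span_nil addv0.
case/memv_addP => _ /vlineP[a ->] [w /memv_addP[_ /vlineP[b ->] [v]]].
by case/vlineP=> c -> -> ->; exists a, b, c; rewrite addrA.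
Qed.

Fact frakA_closed r (A B : 'M[F]_3) :
  A \in frakA_space r -> B \in frakA_space r -> [Lie A, B] \in frakA_space r.
Proof.
move=> /frakA_spaceP[a [b [c ->]]] /frakA_spaceP[a' [b' [c' ->]]].
have XV : frakA_X \in frakA_space r by rewrite memv_span // !inE eqxx ?orbT.
have YV : frakA_Y \in frakA_space r by rewrite memv_span // !inE eqxx ?orbT.
have AYV : [Lie frakA_A r, frakA_Y] \in frakA_space r.
  rewrite frakA_lie_AY; case: (r) XV YV => [r'|] XV YV //.
  by rewrite rpredD ?rpredZ.
rewrite !lieDl !lieZl !lieDr !lieZr !liexx.
rewrite [lie frakA_X (frakA_A r)]lieC [lie frakA_Y _]lieC.
rewrite [lie frakA_Y frakA_X]lieC frakA_lie_AX frakA_lie_XY.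
by repeat first [exact: rpred0 | exact: XV | exact: YV | exact: AYV
  | apply: rpredD | apply: rpredZ | rewrite rpredN].
Qed.

Definition frakA (r : option F) : lieSubalg 'M[F]_3 :=
  LieSubalg (@frakA_closed r).

End AlgebraA.

(* Main.v *)
Require Import Defs.
From HB Require Import structures.
From mathcomp Require Import all_boot all_order all_algebra.
From mathcomp Require Import boolp classical_sets.
From mathcomp Require Import ring.

Set Implicit Arguments.
Unset Strict Implicit.
Unset Printing Implicit Defensive.

Import GRing.Theory.
Local Open Scope ring_scope.

(* If P + M were a subalgebra K, then U(L) = U(K); the adjoint representation
   and then a character of L/K show that this forces K = L, so P + M is not a
   subalgebra. By regularity P and M have equal dimension, hence dimension 1, and
   P = <p>, M = <m> with an involution exchanging p and m; put z := [p, m], so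
   that p, m, z is a basis. Applying the involution to [z, p] = a p + b m + c z
   gives [z, m] = -(b p + a m) + c z, and the Jacobi identity becomes
   c (a + b) = 0. If b = -a, then L is H when a = c = 0, and otherwise p acts on
   the abelian ideal <p - m, z> as in some A(r); if c = 0 and b = a <> 0, the ideal
   <p + m, z> gives A(oo); if c = 0 and a^2 <> b^2, then L is sl_2. *)

(** * Consequences of U(L) = U(P)U(M)U(P) in an arbitrary target algebra *)

Section PlusMinus.
Variables (F : fieldType) (L : lieVectType F) (P M : lieSubalg L).

Lemma uea_lift_sub (N : lieSubalg L) (A : algType F) (f : {linear L -> A})
    (fL : forall x y, f [Lie x, y] = f x * f y - f y * f x) (S : A -> Prop) :
  (forall a : F, S a%:A) -> (forall u v, S u -> S v -> S (u + v)) ->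
  (forall u v, S u -> S v -> S (u * v)) ->
  (forall x, x \in (N : {vspace L}) -> S (f x)) ->
  forall u, uea_sub N u -> S (uea_lift f u).
Proof.
move=> S1 SD SM SN _ [t _ <-]; elim/uea_ind: t => t.
rewrite /uea_sub_incl uea_liftE; last exact: uea_sub_lie.
pose liftM := uea_lift_is_monoid_morphism fL.
pose liftP := uea_lift_is_linear fL.
have lift1 : uea_lift f 1 = 1 by case: liftM.
have liftZ a v : uea_lift f (a *: v) = a *: uea_lift f v.
  have lift0 : uea_lift f 0 = 0 by rewrite (uea_liftE fL) /= scale0r.
  by have := liftP a v 0; rewrite addr0 lift0 addr0.
have liftD u v : uea_lift f (u + v) = uea_lift f u + uea_lift f v.
  by have := liftP 1 u v; rewrite !scale1r.
elim: t => [a|x|s IHs t IHt|s IHs t IHt] /=.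
- by rewrite liftZ lift1.
- by rewrite (uea_lift_gen fL); apply/SN/subvsP.
- by rewrite liftD; apply: SD.
- by rewrite liftM.2; apply: SM.
Qed.

(** [S] plays the role of a unital subalgebra of [A]: once it contains the image of P + M, it
    contains the images of U(P) and U(M), hence those of all sums of products from U(P)U(M)U(P),
    which exhaust U(L). *)
Lemma plus_minus_pair_gen (A : algType F) (f : {linear L -> A}) (S : A -> Prop) :
  plus_minus_pair P M ->
  (forall x y, f [Lie x, y] = f x * f y - f y * f x) ->
  (forall a : F, S a%:A) -> (forall u v, S u -> S v -> S (u + v)) ->
  (forall u v, S u -> S v -> S (u * v)) ->
  (forall x, x \in (P + M)%VS -> S (f x)) ->
  forall x, S (f x).
Proof.
move=> [_ UL] fL S1 SD SM SK x.
have liftM := (uea_lift_is_monoid_morphism fL).2.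
have liftP := uea_lift_is_linear fL.
have lspanS (T : set (uea L)) : (forall u, T u -> S (uea_lift f u)) ->
    forall u, lspan T u -> S (uea_lift f u).
  move=> TS _ [n [c [v [Tv ->]]]].
  elim: n c v Tv => [|n IH] c v Tv.
    by rewrite big_ord0 (uea_liftE fL); exact: S1.
  rewrite big_ord_recl liftP -mulr_algl; apply: (SD); last exact: IH.
  exact/SM/TS.
have SP : forall u, uea_sub P u -> S (uea_lift f u).
  by apply: uea_lift_sub => // y Py; apply: SK; rewrite memvE (subv_trans _ (addvSl P M)).
have SM' : forall u, uea_sub M u -> S (uea_lift f u).
  by apply: uea_lift_sub => // y My; apply: SK; rewrite memvE (subv_trans _ (addvSr P M)).
rewrite -(uea_lift_gen fL).
have : (setT : set (uea L)) (uea_gen x) by [].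
rewrite UL; apply: (lspanS) => _ [u + [v Pv <-]]; rewrite liftM => Su.
apply: (SM); last exact: SP.
move: u Su; apply: (lspanS) => _ [u Pu [w Mw <-]]; rewrite liftM.
by apply: SM; [apply: SP | apply: SM'].
Qed.

End PlusMinus.

(** * The sum P + M is not a subalgebra *)

Section NotClosed.
Variables (F : fieldType) (L : lieVectType F) (P M : lieSubalg L).

(** [plus_minus_pair_gen] is applied with three choices of [S]: the endomorphisms preserving K,
    those acting as a scalar modulo K, and the constants in F[X]. *)
Lemma plus_minus_sum_not_subalg :
  plus_minus_pair P M ->
  ~ (forall x y, x \in (P + M)%VS -> y \in (P + M)%VS -> [Lie x, y] \in (P + M)%VS).
Proof.
move=> pm clK; set K := (P + M)%VS in clK.
have [x0 x0K] : exists x, x \notin K.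
  apply: contrapT => H; case: pm => + _; apply; apply/vspaceP => x.
  by rewrite memvf; apply: contrapT => /negP xK; apply: H; exists x.
have x0N0 : x0 != 0 by apply: contraNneq x0K => ->; rewrite mem0v.
have dimL : (0 < dim L)%N.
  rewrite -dimvf lt0n dimv_eq0; apply: contraNneq x0N0 => L0.
  by rewrite -memv0 -L0 memvf.
(* The product f * g of lfun_algType is g \o f, hence the right adjoint action. *)
have [ad adE] : {ad : L -> 'End(L) | forall x v, ad x v = [Lie v, x]}.
  by exists (fun x => - linfun (lie x)) => x v; rewrite opp_lfunE lfunE /= -lieC.
have ad_lin : linear ad.
  move=> a x y; apply/lfunP => v.
  by rewrite adE add_lfunE scale_lfunE !adE lieDr lieZr.
pose adm := GRing.isLinear.Build F L (lfun_algType dimL) *:%R ad ad_lin.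
pose adL : {linear L -> lfun_algType dimL} := HB.pack ad adm.
have adLie x y : adL [Lie x, y] = adL x * adL y - adL y * adL x.
  rewrite [RHS](_ : _ = (ad y \o ad x)%VF - (ad x \o ad y)%VF) //.
  rewrite [LHS](_ : _ = ad [Lie x, y]) //; apply/(@lfunP F L L) => v.
  rewrite add_lfunE opp_lfunE !comp_lfunE !adE.
  rewrite (lieC [Lie v, x]) (lieC [Lie v, y]) (lieC v y) (linearN (lie x)) opprK -opprD.
  by apply/eqP; rewrite -addr_eq0 [_ + lie x _]addrC addrA lie_jacobi.
(* U(K) preserves K in the adjoint representation, so K is an ideal. *)
have K_ideal v x : v \in K -> [Lie v, x] \in K.
  rewrite -adE; move: v.
  pose S (g : lfun_algType dimL) := forall v, v \in K -> (g : 'End(L)) v \in K.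
  apply: (plus_minus_pair_gen (f := adL) (S := S) pm adLie).
  - by move=> a v Kv; rewrite scale_lfunE id_lfunE rpredZ.
  - by move=> f g Sf Sg v Kv; rewrite add_lfunE rpredD ?Sf ?Sg.
  - by move=> f g Sf Sg v Kv; rewrite comp_lfunE Sg // Sf.
  - by move=> y Ky v Kv; rewrite [_ v]adE clK.
(* As K is an ideal, U(K) acts on L / K by scalars. *)
have ad_scal x : exists c, forall v, [Lie v, x] - c *: v \in K.
  pose S (g : lfun_algType dimL) := exists c, forall v, (g : 'End(L)) v - c *: v \in K.
  have [] : S (adL x); last by move=> c cP; exists c => v; rewrite -adE.
  apply: (plus_minus_pair_gen (f := adL) (S := S) pm adLie).
  - by move=> a; exists a => v; rewrite scale_lfunE id_lfunE subrr mem0v.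
  - move=> f g [a fa] [b gb]; exists (a + b) => v.
    by rewrite add_lfunE scalerDl opprD addrACA rpredD.
  - move=> f g [a fa] [b gb]; exists (b * a) => v.
    rewrite [X in X - _](_ : _ = (g : 'End(L)) ((f : 'End(L)) v)); last by rewrite comp_lfunE.
    (* This splits g (f v) - b a v as (g (f v) - b f v) + b (f v - a v). *)
    rewrite -(subrK (b *: (f : 'End(L)) v) (_ ((f : 'End(L)) v))) -addrA rpredD //.
    by rewrite -scalerA -scalerBr rpredZ.
  - by move=> y Ky; exists 0 => v; rewrite [_ v]adE scale0r subr0 lieC rpredN K_ideal.
have LL_K x y : [Lie x, y] \in K.
  (* For x outside K, the choice v = x turns [x, x] = 0 into c x in K, so c = 0. *)
  case xK : (x \in K); first exact: K_ideal.
  have [c cP] := ad_scal x.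
  have := cP x; rewrite liexx add0r rpredN rpredZeq xK orbF => /eqP c0.
  by have := cP y; rewrite c0 scale0r subr0 lieC rpredN.
have [chi [chiK chi0]] : exists chi : {linear L -> F^o},
    (forall x, x \in K -> chi x = 0) /\ chi x0 != 0.
  (* [chi] is a coordinate that detects the component [w] of [x0] off K, taken after v - projv K v,
     which kills K. *)
  pose w := x0 - projv K x0; pose B := vbasis {:L}.
  have w0 : w != 0.
    by rewrite subr_eq0; apply: contraNneq x0K => ->; exact: memv_proj.
  have [i qi] : exists i, coord B i w != 0.
    apply: contrapT => H; case/eqP: w0.
    rewrite (coord_vbasis (memvf w)) big1 // => i _.
    by have [->|ci] := eqVneq (coord B i w) 0; [rewrite scale0r | case: H; exists i].
  pose chi (v : L) : F^o := coord B i (v - projv K v).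
  have chi_lin : linear chi.
    by move=> a u v; rewrite /chi linearP opprD addrACA -scalerBr linearP.
  pose chim := GRing.isLinear.Build F L F^o *:%R chi chi_lin.
  pose chiL : {linear L -> F^o} := HB.pack chi chim.
  exists chiL; split=> // v Kv.
  by rewrite /= /chi projv_id // subrr linear0.
(* As [chi] vanishes on brackets and F[X] is commutative, chi(x) X respects brackets. It sends K to
   0 but [x0] to a polynomial of degree 1, outside the constants. *)
have f_lin : linear (fun x => chi x *: 'X : {poly F}).
  by move=> a x y; rewrite linearP scalerDl scalerA.
pose fm := GRing.isLinear.Build F L {poly F} *:%R _ f_lin.
pose f : {linear L -> {poly F}} := HB.pack (fun x => chi x *: 'X : {poly F}) fm.
pose S (p : {poly F}) := (size p <= 1)%N.
have : S (f x0).
  apply: (plus_minus_pair_gen (f := f) (S := S) pm).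
  - by move=> x y; rewrite [LHS]/= chiK ?LL_K // scale0r [X in _ - X]mulrC subrr.
  - by move=> a; rewrite /S alg_polyC size_polyC_leq1.
  - by move=> u v Su Sv; apply: leq_trans (size_polyD _ _) _; rewrite geq_max; apply/andP.
  - move=> u v /size1_polyC -> /size1_polyC ->.
    by rewrite /S -polyCM size_polyC_leq1.
  - by move=> x Kx; rewrite /S /= chiK // scale0r size_poly0.
by rewrite /S /= size_scale // size_polyX.
Qed.

End NotClosed.

(** * Bases of three vectors and Lie isomorphisms read off from them *)

Section Triples.
Variables (F : fieldType) (V : vectType F).
Implicit Types x y z v : V.

Lemma mem_span3P x y z v :
  reflect (exists a b c, v = a *: x + b *: y + c *: z) (v \in <<[:: x; y; z]>>%VS).
Proof.
apply: (iffP idP) => [|[a [b [c ->]]]]; last first.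
  by rewrite !rpredD // rpredZ // memv_span // !inE eqxx ?orbT.
rewrite !span_cons span_nil addv0.
case/memv_addP => _ /vlineP[a ->] [w /memv_addP[_ /vlineP[b ->] [u]]].
by case/vlineP=> c -> -> ->; exists a, b, c; rewrite addrA.
Qed.

Lemma free3P x y z :
  reflect (forall a b c, a *: x + b *: y + c *: z = 0 -> [/\ a = 0, b = 0 & c = 0])
          (free [:: x; y; z]).
Proof.
apply: (iffP (@freeP _ _ 3 [tuple x; y; z])) => [fr a b c e|fr k].
  have := fr (fun i => [:: a; b; c]`_i).
  rewrite !big_ord_recl big_ord0 /= addr0 addrA => /(_ e) k0.
  by split; [have := k0 ord0|have := k0 (lift ord0 ord0)|have := k0 ord_max].
rewrite !big_ord_recl big_ord0 /= addr0 addrA => /fr[k0 k1 k2] i.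
case: i => [[|[|[|//]]] ilt].
- by rewrite -[RHS]k0; congr k; apply: val_inj.
- by rewrite -[RHS]k1; congr k; apply: val_inj.
- by rewrite -[RHS]k2; congr k; apply: val_inj.
Qed.

End Triples.

(** Bilinearity and antisymmetry reduce compatibility with brackets to three pairs. The hypothesis
    quantifies over [f] so that each use can expand brackets in the basis of [L] and evaluate [f] by
    linearity. *)
Lemma lie_iso3 (F : fieldType) (L L' : lieVectType F) (x y z : L) (x' y' z' : L') :
  basis_of fullv [:: x; y; z] -> basis_of fullv [:: x'; y'; z'] ->
  (forall f : {linear L -> L'}, f x = x' -> f y = y' -> f z = z' ->
     [/\ f [Lie x, y] = [Lie x', y'], f [Lie x, z] = [Lie x', z']
       & f [Lie y, z] = [Lie y', z']]) ->
  lie_iso L L'.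
Proof.
move=> B B' H.
have spanB v : exists a b c, v = a *: x + b *: y + c *: z.
  by apply/mem_span3P; rewrite (span_basis B) memvf.
have spanB' v : exists a b c, v = a *: x' + b *: y' + c *: z'.
  by apply/mem_span3P; rewrite (span_basis B') memvf.
have [f /(_ (basis_free B) erefl) [fx fy fz]] := linear_of_free [:: x; y; z] [:: x'; y'; z'].
have [g /(_ (basis_free B') erefl) [gx gy gz]] := linear_of_free [:: x'; y'; z'] [:: x; y; z].
have [fxy fxz fyz] := H f fx fy fz.
have fE a b c : f (a *: x + b *: y + c *: z) = a *: x' + b *: y' + c *: z'.
  by rewrite !linearD !linearZ fx fy fz.
have gE a b c : g (a *: x' + b *: y' + c *: z') = a *: x + b *: y + c *: z.
  by rewrite !linearD !linearZ gx gy gz.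
have fD u v : f (u + v) = f u + f v by exact: linearD.
have fN u : f (- u) = - f u by exact: linearN.
have fZ k u : f (k *: u) = k *: f u by exact: linearZ.
exists f; split.
  move=> u v; have [a [b [c ->]]] := spanB u; have [a' [b' [c' ->]]] := spanB v.
  rewrite !fE !lieDl !lieDr !lieZl !lieZr !liexx.
  rewrite (lieC y x) (lieC z x) (lieC z y) (lieC y' x') (lieC z' x') (lieC z' y').
  by rewrite !scaler0 !scalerN !addr0 !add0r !(fD, fN, fZ) fxy fxz fyz.
by exists g => v; [have [a [b [c ->]]] := spanB v | have [a [b [c ->]]] := spanB' v];
  rewrite ?(fE, gE).
Qed.

Lemma basis_of_full3 (F : fieldType) (V : vectType F) (x y z : V) :
  (forall v, exists a b c, v = a *: x + b *: y + c *: z) ->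
  (forall a b c, a *: x + b *: y + c *: z = 0 -> [/\ a = 0, b = 0 & c = 0]) ->
  basis_of fullv [:: x; y; z].
Proof.
move=> spV /free3P frV; rewrite basisEfree frV subvf.
by rewrite -(eqnP frV); apply/dimvS/subvP => v _; apply/mem_span3P.
Qed.

(** * Bracket relations that characterise H and A(r) *)

Section Recognition.
Variables (F : closedFieldType) (L : lieVectType F).
Hypothesis dimL : \dim {:L} = 3%N.

Lemma basis_span3 (x y z u v w : L) : basis_of fullv [:: x; y; z] ->
  x \in <<[:: u; v; w]>>%VS -> y \in <<[:: u; v; w]>>%VS ->
  z \in <<[:: u; v; w]>>%VS -> basis_of fullv [:: u; v; w].
Proof.
move=> B xs ys zs; rewrite basisEdim dimL andbT -(span_basis B).
by apply/span_subvP => t; rewrite !inE => /or3P[] /eqP->.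
Qed.

Lemma lie_iso_heisenberg (p m z : L) : basis_of fullv [:: p; m; z] ->
  [Lie p, m] = z -> [Lie p, z] = 0 -> [Lie m, z] = 0 -> lie_iso L (heisenberg F).
Proof.
move=> B pm pz mz; apply: (lie_iso3 B (heis_basis F)) => f fx fy fz.
by have [-> -> ->] := heis_brackets F; rewrite pm pz mz (linear0 f).
Qed.

Lemma frakA_A_basis (r : option F) a b c :
  a *: frakA_A r + b *: frakA_X F + c *: frakA_Y F = 0 -> [/\ a = 0, b = 0 & c = 0].
Proof.
move/matrixP => e.
(* The entries (1,0), (0,2) and (1,2) isolate a, b and c for either shape of [frakA_A r]. *)
have := e (inord 1) (inord 0); have := e (inord 0) (inord 2); have := e (inord 1) (inord 2).
case: r {e} => [r|] /=; rewrite !mxE !inordK //= !(mulr0, mulr1, addr0, add0r);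
  by move=> -> -> ->.
Qed.

Lemma lie_iso_frakA (A u v : L) (r : option F) : basis_of fullv [:: A; u; v] ->
  [Lie A, u] = v -> [Lie u, v] = 0 ->
  [Lie A, v] = (if r is Some r' then r' *: u + v else u) ->
  lie_iso L (lieSub (frakA r)).
Proof.
move=> B Au uv Av.
have AS : frakA_A r \in (frakA r : {vspace _}) by rewrite memv_span // !inE eqxx.
have XS : frakA_X F \in (frakA r : {vspace _}) by rewrite memv_span // !inE eqxx orbT.
have YS : frakA_Y F \in (frakA r : {vspace _}) by rewrite memv_span // !inE eqxx !orbT.
pose A' : lieSub (frakA r) := Subvs AS.
pose X' : lieSub (frakA r) := Subvs XS.
pose Y' : lieSub (frakA r) := Subvs YS.
have B' : basis_of fullv [:: A'; X'; Y'].
  apply: basis_of_full3 => [w|a b c /(congr1 (@lieSub_val _ _ _))].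
    have /frakA_spaceP[a [b [c e]]] := subvsP w.
    exists a, b, c; apply: lieSub_val_inj.
    by rewrite !linearD !linearZ.
  by rewrite !linearD !linearZ linear0 => /frakA_A_basis.
apply: (lie_iso3 B B') => f fA fu fv.
split; apply: lieSub_val_inj; rewrite lieSub_val_lie.
- by rewrite Au fv; rewrite [RHS]frakA_lie_AX.
- have fAv o : lieSub_val (f (if o is Some s then s *: u + v else u)) =
      if o is Some s then s *: frakA_X F + frakA_Y F else frakA_X F.
    by case: o => [s|]; rewrite ?linearP ?fu ?fv ?linearP.
  by rewrite Av fAv [RHS]frakA_lie_AY.
- by rewrite uv (linear0 f) linear0 [RHS]frakA_lie_XY.
Qed.

(** Algebraic closedness enters here: the root serves as the square root that normalises A(oo), and
    as a matrix entry in the sl_2 case. *)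
Lemma quadratic_root (b c : F) : exists t, t ^+ 2 = b * t + c.
Proof.
have [t tE] := solve_monicpoly (fun i => [:: c; b]`_i) (isT : (0 < 2)%N).
by exists t; rewrite tE !big_ord_recl big_ord0 /= expr0 expr1 mulr1 addr0 addrC.
Qed.

(** Replacing (A, v) by (k A, k v) keeps [A, u] = v and gives [k A, k v] = k^2 al u + k be (k v). If
    be <> 0, take k = 1 / be, so r = al / be^2; if be = 0, take k = 1 / t with t^2 = al, so r =
    oo. *)
Lemma lie_iso_frakA_ex (A u v : L) (al be : F) : basis_of fullv [:: A; u; v] ->
  [Lie A, u] = v -> [Lie u, v] = 0 -> [Lie A, v] = al *: u + be *: v ->
  (al != 0) || (be != 0) -> exists r, lie_iso L (lieSub (frakA r)).
Proof.
move=> B Au uv Av nz.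
have scaled k r : k != 0 ->
    [Lie k *: A, k *: v] = (if r is Some r' then r' *: u + k *: v else u) ->
    exists r, lie_iso L (lieSub (frakA r)).
  move=> k0 e; exists r; apply: (@lie_iso_frakA (k *: A) u (k *: v) r) => //.
  - have inS (w : L) :
        w \in [:: k *: A; u; k *: v] -> w \in <<[:: k *: A; u; k *: v]>>%VS.
      exact: memv_span.
    apply: basis_span3 B _ _ _.
    + by rewrite -{1}(scalerK k0 A) rpredZ // inS // !inE eqxx.
    + by rewrite inS // !inE eqxx orbT.
    + by rewrite -{1}(scalerK k0 v) rpredZ // inS // !inE eqxx !orbT.
  - by rewrite lieZl Au.
  - by rewrite lieZr uv scaler0.
have [be0|be0] := eqVneq be 0.
  have [t tE] := quadratic_root 0 al; rewrite mul0r add0r in tE.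
  have t0 : t != 0 by rewrite be0 eqxx orbF -tE sqrf_eq0 in nz.
  apply: (scaled t^-1 None); rewrite ?invr_eq0 //.
  rewrite lieZl lieZr Av be0 scale0r addr0 !scalerA -tE.
  by rewrite -[RHS]scale1r; congr (_ *: _); field.
apply: (scaled be^-1 (Some (al / be ^+ 2))); rewrite ?invr_eq0 //.
rewrite lieZl lieZr Av !scalerDr !scalerA.
by congr (_ *: _ + _ *: _); field.
Qed.

(** * Two by two matrices and the recognition of sl_2 *)

Definition mx2 (a b c d : F) : 'M[F]_2 :=
  \matrix_(i < 2, j < 2) nth 0 (nth [::] [:: [:: a; b]; [:: c; d]] i) j.

Lemma mx2_lie a b c d a' b' c' d' : [Lie mx2 a b c d, mx2 a' b' c' d'] =
  mx2 (b * c' - b' * c) (a * b' + b * d' - a' * b - b' * d)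
      (c * a' + d * c' - c' * a - d' * c) (c * b' - c' * b).
Proof.
rewrite [LHS]/(mx_lie _ _) /mx_lie; apply/matrixP => i j.
rewrite !mxE !big_ord_recr !big_ord0 /= !mxE.
by case: i => [[|[|//]] ?]; case: j => [[|[|//]] ?] /=; ring.
Qed.

Lemma mx2D a b c d a' b' c' d' :
  mx2 a b c d + mx2 a' b' c' d' = mx2 (a + a') (b + b') (c + c') (d + d').
Proof.
apply/matrixP => i j; rewrite !mxE.
by case: i => [[|[|//]] ?]; case: j => [[|[|//]] ?].
Qed.

Lemma mx2Z k a b c d : k *: mx2 a b c d = mx2 (k * a) (k * b) (k * c) (k * d).
Proof.
apply/matrixP => i j; rewrite !mxE.
by case: i => [[|[|//]] ?]; case: j => [[|[|//]] ?].
Qed.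

Lemma mx2_0 : mx2 0 0 0 0 = 0.
Proof.
by apply/matrixP => [[[|[|//]] ?] [[|[|//]] ?]]; rewrite !mxE.
Qed.

Lemma mx2_inj a b c d a' b' c' d' : mx2 a b c d = mx2 a' b' c' d' ->
  [/\ a = a', b = b', c = c' & d = d'].
Proof.
move/matrixP=> e; have := (e 0 0, e 0 1, e 1 0, e 1 1).
by rewrite !mxE /= => -[[[-> ->] ->] ->].
Qed.

Lemma mx2_sl2 a b c : mx2 a b c (- a) \in (sl2 F : {vspace _}).
Proof. by rewrite mem_sl2_space /mxtrace !big_ord_recl big_ord0 !mxE /= addr0 subrr. Qed.

Lemma sl2_mx2 (A : 'M[F]_2) : A \in (sl2 F : {vspace _}) ->
  exists a b c, A = mx2 a b c (- a).
Proof.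
rewrite mem_sl2_space /mxtrace !big_ord_recl big_ord0 addr0 addr_eq0 => /eqP e.
exists (A 0 0), (A 0 1), (A 1 0); apply/matrixP => i j; rewrite !mxE.
case: i => [[|[|//]] ?]; case: j => [[|[|//]] ?] /=; last rewrite e opprK;
  by congr (A _ _); apply: val_inj.
Qed.

Lemma lie_iso_sl2 (p m z : L) (a b : F) : (2 : F) != 0 ->
  basis_of fullv [:: p; m; z] -> [Lie p, m] = z ->
  [Lie p, z] = - (a *: p + b *: m) -> [Lie m, z] = b *: p + a *: m ->
  a ^+ 2 != b ^+ 2 -> lie_iso L (lieSub (sl2 F)).
Proof.
move=> two0 B pm pz mz nz.
(* In sl_2, [[P, M], P] = 2 tr(P M) P - 2 tr(P^2) M, and symmetrically for M;
   so one needs tr(P^2) = tr(M^2) = - b / 2 and tr(P M) = a / 2. With zero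
   diagonals and P_01 = 1 this is the quadratic equation for t = M_01. *)
have [t tE] : exists t, b * t ^+ 2 + 2 * a * t + b = 0.
  have [->|b0] := eqVneq b 0; first by exists 0; ring.
  have [t tE] := quadratic_root (- (2 * a / b)) (-1).
  by exists t; rewrite tE; field.
have k0 : a + b * t != 0.
  (* At the root t one has (a + b t)^2 = a^2 - b^2. *)
  apply: contraNneq nz => k0; apply/eqP.
  transitivity ((a + b * t) ^+ 2 - b * (b * t ^+ 2 + 2 * a * t + b) + b ^+ 2); first by ring.
  by rewrite k0 tE expr0n mulr0 subr0 add0r.
have four0 : (4 : F) != 0 by rewrite (_ : 4 = 2 * 2) ?mulf_neq0 //; ring.
(* The lower left entries solve tr(P^2) = - b / 2 and tr(P M) = a / 2; Z is [P, M]. *)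
pose P : lieSub (sl2 F) := Subvs (mx2_sl2 0 1 (- b / 4)).
pose M : lieSub (sl2 F) := Subvs (mx2_sl2 0 t (a / 2 + b * t / 4)).
pose Z : lieSub (sl2 F) := Subvs (mx2_sl2 ((a + b * t) / 2) 0 0).
have valE k l n : lieSub_val (k *: P + l *: M + n *: Z) =
    mx2 (n * ((a + b * t) / 2)) (k + l * t)
        (- k * b / 4 + l * (a / 2 + b * t / 4)) (- (n * ((a + b * t) / 2))).
  by rewrite !linearD !linearZ /= [LHS]/= !mx2Z !mx2D; congr mx2; ring.
have B' : basis_of fullv [:: P; M; Z].
  apply: basis_of_full3 => [w|k l n].
    have [h [e [f wE]]] := sl2_mx2 (subvsP w).
    (* The upper right entry gives k = e - y t; the lower left one then becomes y (a + b t) / 2 = f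
       + e b / 4. *)
    pose y := (f + e * b / 4) / ((a + b * t) / 2).
    exists (e - y * t), y, (h / ((a + b * t) / 2)); apply: lieSub_val_inj.
    by rewrite valE [LHS]wE /y; congr mx2; field; rewrite ?k0 ?two0 ?four0.
  move/(congr1 (@lieSub_val _ _ _)); rewrite valE linear0 -mx2_0.
  case/mx2_inj => /eqP n0 /eqP kl lk _.
  rewrite !mulf_eq0 invr_eq0 (negPf k0) (negPf two0) !orbF in n0.
  rewrite addr_eq0 in kl; rewrite (eqP kl) in lk.
  have /eqP : l * ((a + b * t) / 2) = 0 by rewrite -lk; field; rewrite ?two0 ?four0.
  rewrite !mulf_eq0 invr_eq0 (negPf k0) (negPf two0) !orbF => /eqP l0.
  by rewrite (eqP kl) l0 mul0r oppr0 (eqP n0).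
apply: (lie_iso3 B B') => f fp fm fz.
have fN u : f (- u) = - f u by exact: linearN.
have fD k l : f (k *: p + l *: m) = k *: P + l *: M + 0 *: Z.
  by rewrite linearD !linearZ fp fm scale0r addr0.
(* The off-diagonal entries of [M, Z] are correct modulo the equation for t; [k] is the multiple of
   it to be added. *)
have rel x y k : x = y + k * (b * t ^+ 2 + 2 * a * t + b) -> x = y.
  by rewrite tE mulr0 addr0.
rewrite pm pz mz fN !fD fz; split; apply: lieSub_val_inj; rewrite lieSub_val_lie.
- by rewrite [RHS]mx2_lie [LHS]/=; congr mx2; field; rewrite ?two0 ?four0.
- rewrite [LHS]linearN [X in - X]valE -scaleN1r mx2Z [RHS]mx2_lie.
  by congr mx2; field; rewrite ?two0 ?four0.
- rewrite valE [RHS]mx2_lie; congr mx2.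
  + by field; rewrite ?two0 ?four0.
  + by apply: (rel _ _ 1); field; rewrite ?two0 ?four0.
  + by apply: (rel _ _ (- (b / 4))); field; rewrite ?two0 ?four0.
  + by field; rewrite ?two0 ?four0.
Qed.

End Recognition.

(** * The case distinction, and the basis exchanged by the involution *)

Section Main.
Variables (F : closedFieldType) (L : lieVectType F).
Hypothesis dimL : \dim {:L} = 3%N.

Lemma lie_iso_of_swap (p m z : L) (a b c : F) : (2 : F) != 0 ->
  basis_of fullv [:: p; m; z] -> [Lie p, m] = z ->
  [Lie z, p] = a *: p + b *: m + c *: z ->
  [Lie z, m] = - (b *: p + a *: m) + c *: z ->
  [\/ lie_iso L (lieSub (sl2 F)),
      lie_iso L (heisenberg F)
    | exists r : option F, lie_iso L (lieSub (frakA r))].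
Proof.
move=> two0 B pm zp zm.
(* In these coordinates each bracket identity becomes three ring identities. *)
pose lc k l n := k *: p + l *: m + n *: z.
have lcD k l n k' l' n' : lc k l n + lc k' l' n' = lc (k + k') (l + l') (n + n').
  by rewrite /lc !scalerDl addrACA; congr (_ + _); rewrite addrACA.
have lcZ t k l n : t *: lc k l n = lc (t * k) (t * l) (t * n).
  by rewrite /lc !scalerDr !scalerA.
have lcN k l n : - lc k l n = lc (- k) (- l) (- n).
  by rewrite -scaleN1r lcZ !mulN1r.
have lc0 : 0 = lc 0 0 0 by rewrite /lc !scale0r !addr0.
have lcp : p = lc 1 0 0 by rewrite /lc !scale0r !addr0 scale1r.
have lcm : m = lc 0 1 0 by rewrite /lc !scale0r addr0 add0r scale1r.
have lcz : z = lc 0 0 1 by rewrite /lc !scale0r !add0r scale1r.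
have zm' : [Lie z, m] = lc (- b) (- a) c by rewrite zm /lc opprD !scaleNr.
have lieP k l n : [Lie p, lc k l n] = lc (- n * a) (- n * b) (l - n * c).
  rewrite !lieDr !lieZr liexx pm [lie p z]lieC zp -/(lc _ _ _) {1}lc0 {1}lcz.
  by rewrite lcN !lcZ !lcD; congr lc; ring.
have lieM k l n : [Lie m, lc k l n] = lc (n * b) (n * a) (- k - n * c).
  rewrite !lieDr !lieZr liexx [lie m p]lieC pm [lie m z]lieC zm' {1}lc0 {1}lcz.
  by rewrite !lcN !lcZ !lcD; congr lc; ring.
have liez k l n : [Lie z, lc k l n] = lc (k * a - l * b) (k * b - l * a) ((k + l) * c).
  rewrite !lieDr !lieZr liexx zp -/(lc _ _ _) zm' {1}lc0.
  by rewrite !lcZ !lcD; congr lc; ring.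
have frB := elimT (free3P _ _ _) (basis_free B).
(* This is the p-coordinate of the Jacobi identity for z, p, m. *)
have cab : c * (a + b) = 0.
  have := lie_jacobi z p m; rewrite pm liexx add0r zp [lie m z]lieC zm' lcN lieP lieM lcD.
  by case/frB => <- _ _; ring.
have pz : [Lie p, z] = - (a *: p + b *: m + c *: z) by rewrite lieC zp.
have mz : [Lie m, z] = b *: p + a *: m - c *: z.
  by rewrite lieC zm opprD opprK.
have p_ba (k e : F) : k != 0 -> e ^+ 2 = 1 ->
    basis_of fullv [:: p; p + e *: m; k *: z].
  move=> k0 e1; have e0 : e != 0 by rewrite -sqrf_eq0 e1 oner_eq0.
  apply: (basis_span3 dimL B); apply/mem_span3P.
  - by exists 1, 0, 0; rewrite scale1r !scale0r !addr0.
  - exists (- e^-1), e^-1, 0.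
    by rewrite scalerDr addrA scaleNr addNr add0r scalerK // scale0r addr0.
  - by exists 0, 0, k^-1; rewrite !scale0r !add0r scalerK.
have [bNa|bNa] := eqVneq (a + b) 0.
  have be : b = - a by apply/eqP; rewrite -addr_eq0 addrC bNa.
  case: (boolP ((a != 0) || (c != 0))) => [nz|].
    apply: Or33.
    (* With u = p - m and v = [p, u] = - z, b = - a gives [p, v] = [z, p] = a u - c v. *)
    have {}B : basis_of fullv [:: p; p - m; - z].
      rewrite -scaleN1r -(scaleN1r z); apply: p_ba; first by rewrite oppr_eq0 oner_eq0.
      by rewrite sqrrN expr1n.
    apply: (lie_iso_frakA_ex dimL B (al := a) (be := - c)); rewrite ?oppr_eq0 //.
    - rewrite {2}lcp {1}lcm lcN lcD lieP lcz lcN; congr lc; ring.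
    - rewrite -(scaleN1r z) lieZr lieC scaleN1r opprK {1}lcp {1}lcm lcN lcD liez lc0 be.
      by congr lc; ring.
    - rewrite {1}lcz lcN lieP lcp lcm lcz !lcN lcD !lcZ lcD; congr lc; rewrite ?be; ring.
  rewrite negb_or !negbK => /andP[/eqP a0 /eqP c0]; apply: Or32.
  apply: (lie_iso_heisenberg B) => //.
  - by rewrite pz be a0 c0 oppr0 !scale0r !addr0 oppr0.
  - by rewrite mz be a0 c0 oppr0 !scale0r subr0 addr0.
move/eqP: cab; rewrite mulf_eq0 (negPf bNa) orbF => /eqP c0.
move: zp zm pz mz; rewrite c0 !scale0r !(addr0, subr0) => zp zm pz mz.
have [ab|ab] := eqVneq a b.
  apply: Or33.
  (* With u = p + m and v = [p, u] = z, one gets [p, v] = - a u, and a <> 0 because a + b <> 0. *)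
  have {}B : basis_of fullv [:: p; p + m; z].
    by rewrite -[m]scale1r -[z]scale1r; apply: p_ba; rewrite ?oner_eq0 // expr1n.
  apply: (lie_iso_frakA_ex dimL B (al := - a) (be := 0)).
  - by rewrite lieDr liexx add0r.
  - by rewrite lieDl pz mz ab addNr.
  - by rewrite pz ab scalerDr scale0r addr0 !scaleNr opprD.
  - rewrite oppr_eq0 eqxx orbF; apply: contraNneq bNa => a0.
    by rewrite -ab a0 addr0.
apply: Or31; apply: (lie_iso_sl2 two0 B pm pz mz).
by rewrite -subr_eq0 subr_sqr mulf_neq0 // subr_eq0.
Qed.

(** The involution gives P and M equal dimension, and P, M meet in 0, so 2 dim P <= 3. Dimension 0
    would make P + M = 0 a subalgebra, so P and M are lines. *)
Lemma plus_minus_swap_basis (P M : lieSubalg L) :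
  regular_plus_minus_pair P M ->
  exists (p m z : L) (s : {linear L -> L}),
   [/\ basis_of fullv [:: p; m; z], [Lie p, m] = z, s p = m, s m = p & lie_morphism s].
Proof.
move=> [pm PM0 [s [[smor sbij ss _] sP]]].
have s2 x : s (s x) = x by rewrite -comp_lfunE ss id_lfunE.
have ncl := plus_minus_sum_not_subalg pm.
have dimM : \dim M = \dim P.
  rewrite -sP limg_dim_eq //; apply/eqP; rewrite -subv0; apply/subvP => x.
  rewrite memv_cap memv_ker memv0 => /andP[_ /eqP sx0].
  by rewrite -(s2 x) sx0 linear0.
have : (\dim P + \dim P <= 3)%N.
  by rewrite -{2}dimM -dimv_disjoint_sum // -dimL dimvS ?subvf.
case dimP : (\dim P) => [|[|d]]; last by rewrite addnS addSn addnS.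
  move=> _; case: ncl => x y.
  have /eqP -> : (P : {vspace L}) == 0%VS by rewrite -dimv_eq0 dimP.
  have /eqP -> : (M : {vspace L}) == 0%VS by rewrite -dimv_eq0 dimM dimP.
  by rewrite addv0 !memv0 => _ /eqP ->; rewrite linear0.
move=> _; pose p := vpick P; pose m := s p.
have Pp : (P : {vspace L}) = <[p]>%VS.
  apply/esym/eqP; rewrite eqEdim -memvE memv_pick dimP dim_vline vpick0.
  by rewrite -dimv_eq0 dimP.
have Mm : (M : {vspace L}) = <[m]>%VS by rewrite -sP Pp limg_line.
exists p, m, [Lie p, m], s; split=> //; last exact: s2.
have zK : [Lie p, m] \notin (P + M)%VS.
  (* Brackets of elements of <p> + <m> are multiples of [p, m], so its membership would make P + M a
     subalgebra. *)
  apply/negP => zK; case: ncl => x y.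
  rewrite {1 2}Pp {1 2}Mm.
  case/memv_addP => _ /vlineP[k ->] [_ /vlineP[l ->] ->].
  case/memv_addP => _ /vlineP[k' ->] [_ /vlineP[l' ->] ->].
  rewrite !lieDl !lieDr !lieZl !lieZr !liexx (lieC m p) !scaler0 add0r addr0.
  by rewrite !scalerN rpredB ?rpredZ.
have dimPM : \dim (<[p]> + <[m]>) = 2%N.
  by rewrite -Pp -Mm dimv_disjoint_sum // dimM dimP.
rewrite basisEfree subvf dimL andbT (perm_free (_ : perm_eq _ [:: [Lie p, m]; p; m])).
  rewrite free_cons /free span_cons span_seq1 dimPM eqxx andbT.
  by rewrite -Pp -Mm.
exact: permEl (perm_catC [:: p; m] [:: [Lie p, m]]).
Qed.

End Main.

Theorem theorem2p5 (F : closedFieldType) (L : lieVectType F) :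
  [pchar F] =i pred0 ->
  \dim {:L} = 3%N ->
  (exists P M : lieSubalg L, regular_plus_minus_pair P M) ->
  [\/ lie_iso L (lieSub (sl2 F)),
      lie_iso L (heisenberg F)
    | exists r : option F, lie_iso L (lieSub (frakA r))].
Proof.
move=> char0 dimL [P [M /(plus_minus_swap_basis dimL)]].
move=> [p [m [z [s [B pm sp sm sLie]]]]].
have sz : s z = - z by rewrite -pm sLie sp sm lieC.
have /mem_span3P[a [b [c zp]]] : [Lie z, p] \in <<[:: p; m; z]>>%VS.
  by rewrite (span_basis B) memvf.
apply: (@lie_iso_of_swap F L dimL p m z a b c _ B pm zp).
  by rewrite (proj1 (pcharf0P F) char0).
have szp : s [Lie z, p] = a *: m + b *: p + c *: - z.
  by rewrite zp !linearD !linearZ sp sm sz.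
(* The involution turns [z, p] into [- z, m], so its formula with p and m exchanged and z negated is
   that of - [z, m]. *)
apply: oppr_inj; rewrite -scaleN1r -lieZl scaleN1r -sz -{1}sp -sLie szp.
by rewrite scalerN opprD opprK [a *: m + _]addrC.
Qed.
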